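(* (Relations between $\Lambda$ and $\Xi$.) For any composition $I$, in $\mathcal NSym$ we have $$\Lambda^I=(-1)^{|I|}\sum_{J\succeq I}\frac{(-1)^{\ell(J)}}{\pi_u(J,I)}\,\Xi^J,\qquad \Xi^I=(-1)^{|I|}\sum_{J\succeq I}(-1)^{\ell(J)}\,lp(J,I)\,\Lambda^J,$$ where $J$ ranges over compositions.
   Context: $K$ is a unital commutative $\mathbb Q$-algebra and $t$ a central formal parameter. $\mathcal NSym$ is the free unital associative $K$-algebra on noncommuting variables $\Lambda_m$ ($m\ge1$), $\Lambda_0=1$, $\lambda(t)=\sum_{m\ge0}t^m\Lambda_m$. Elements $S_m,\Xi_m$ of $\mathcal NSym$ are defined by $\sigma(t)=\sum_{m\ge0}t^mS_m$, $\xi(t)=\sum_{m\ge1}t^{m-1}\Xi_m$, the unique solutions in $\mathcal NSym[[t]]$ of $\lambda(-t)\sigma(t)=\sigma(t)\lambda(-t)=1$, $\frac{d\sigma(t)}{dt}=\xi(t)\sigma(t)$. A composition is a nonempty finite sequence $I=(i_1,\dots,i_m)$ of positive integers; $\ell(I)=m$, $|I|=\sum i_j$. For a sequence $w=\{w_k\}$, $w^I=w_{i_1}\cdots w_{i_m}$. $lp(I)=i_m$, $\pi_u(I)=\prod_{j=1}^m(i_1+\cdots+i_j)$. $J\succeq I$ means $J$ is a refinement of $I$: $J$ is the concatenation $J_1\cdot J_2\cdots J_m$ of compositions $J_a$ with $|J_a|=i_a$; then $\pi_u(J,I)=\prod_a\pi_u(J_a)$, $lp(J,I)=\prod_alp(J_a)$.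 *)

(* Defs.v *)
From HB Require Import structures.
From mathcomp Require Import all_boot all_order all_algebra.
From mathcomp.multinomials Require Import monalg.

Set Implicit Arguments.
Unset Strict Implicit.
Unset Printing Implicit Defensive.

Import GRing.Theory.
Local Open Scope ring_scope.

Definition is_composition (I : seq nat) : bool :=
  (I != [::]) && all (ltn 0) I.

(* All compositions of n, each listed once (see mem_compositions and
   compositions_uniq): a composition of n.+2 either starts with 1, or is
   obtained by adding 1 to the first part of a composition of n.+1. *)
Fixpoint compositions (n : nat) : seq (seq nat) :=
  match n with
  | 0 => [::]
  | 1 => [:: [:: 1%N]]
  | n'.+1 => [seq (1%N :: J) | J <- compositions n']
               ++ [seq incr_nth J 0 | J <- compositions n']
  end.

Definition lp (I : seq nat) : nat := last 0%N I.

Definition pi_u (I : seq nat) : nat :=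
  (\prod_(j < size I) sumn (take j.+1 I))%N.

(* Length of the shortest prefix of J whose sum is at least i. *)
Fixpoint prefix_len (i : nat) (J : seq nat) : nat :=
  if J is j :: J' then
    if (0 < i)%N then (prefix_len (i - j) J').+1 else 0%N
  else 0%N.

(* When J refines I, blocks I J is the sequence J_1, ..., J_m with
   J = J_1 ... J_m and |J_a| = i_a; it is the only such sequence
   (see blocks_unique).  Its value is irrelevant otherwise. *)
Fixpoint blocks (I J : seq nat) : seq (seq nat) :=
  if I is i :: I' then
    let k := prefix_len i J in take k J :: blocks I' (drop k J)
  else [::].

Definition is_decomposition (I J : seq nat) (B : seq (seq nat)) : bool :=
  [&& all is_composition B, flatten B == J & map sumn B == I].

Definition refines (J I : seq nat) : bool := is_decomposition I J (blocks I J).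

Definition pi_u2 (J I : seq nat) : nat := (\prod_(B <- blocks I J) pi_u B)%N.
Definition lp2 (J I : seq nat) : nat := (\prod_(B <- blocks I J) lp B)%N.

Lemma prefix_len_cat (B R : seq nat) :
  all (ltn 0) B -> prefix_len (sumn B) (B ++ R) = size B.
Proof.
elim: B => [|b B IH] /=; first by case: R.
by case/andP=> b0 Bp; rewrite addn_gt0 b0 addKn IH.
Qed.

Lemma blocks_unique (I J : seq nat) (B : seq (seq nat)) :
  is_decomposition I J B -> blocks I J = B.
Proof.
case/and3P=> + /eqP <- /eqP <-.
elim: B => [//|b B IH] /= /andP[/andP[_ bp] Bp].
by rewrite prefix_len_cat // take_size_cat // drop_size_cat // IH.
Qed.

Lemma refinesP (J I : seq nat) :
  reflect (exists B, is_decomposition I J B) (refines J I).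
Proof.
apply: (iffP idP) => [JI|[B dB]]; first by exists (blocks I J).
by rewrite /refines (blocks_unique dB).
Qed.

Lemma compositionsSS n :
  compositions n.+2 = [seq (1%N :: J) | J <- compositions n.+1]
               ++ [seq incr_nth J 0 | J <- compositions n.+1].
Proof. by []. Qed.

Lemma mem_compositions (n : nat) (I : seq nat) :
  (I \in compositions n) = is_composition I && (sumn I == n).
Proof.
case: n => [|n].
  by rewrite in_nil; case: I => [|[|i] I] //=; rewrite andbF.
elim: n I => [|n IH] I.
  rewrite inE; case: I => [//|[//|i] [|j I]].
    rewrite /is_composition /= addn0 eqSS.
    by case: i.
  rewrite /is_composition /= addSn eqSS addn_eq0 addn_eq0 eqseq_cons andbF.
  by case: j => [|j] //=; rewrite !andbF.
rewrite compositionsSS mem_cat.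
apply/orP/idP => [[/mapP[J]|/mapP[J]]|].
- rewrite IH => /andP[/andP[J0 Jp] /eqP sJ] ->.
  by rewrite /is_composition /= Jp sJ add1n eqxx.
- rewrite IH => /andP[/andP[]]; case: J => [//|j J] _ /= /andP[_ Jp] /eqP sJ ->.
  by rewrite /is_composition /= Jp addSn sJ eqxx.
case: I => [//|[//|[|i]] I] /andP[/andP[_ /= Ip]] sI.
- left; apply/mapP; exists I => //; rewrite IH; case: I Ip sI => [//|i I] Ip sI.
  by rewrite /is_composition Ip.
- right; apply/mapP; exists (i.+1 :: I) => //.
  by rewrite IH /is_composition /= Ip.
Qed.

Lemma compositions_uniq (n : nat) : uniq (compositions n).
Proof.
case: n => [//|]; elim=> [//|n IH]; rewrite compositionsSS cat_uniq.
apply/and3P; split.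
- by rewrite map_inj_uniq // => x y [].
- apply/hasPn => _ /mapP[J + ->]; rewrite mem_compositions.
  by case: J => [//|[|j] J] // _; apply/negP => /mapP[].
- rewrite map_inj_in_uniq // => x y; rewrite !mem_compositions.
  by case: x => // x xs _; case: y => // y ys _ [-> ->].
Qed.

(* A power series in a central parameter t is its sequence of coefficients. *)
Definition series (R : nzRingType) := nat -> R.

Definition ser_one (R : nzRingType) : series R := fun n => (n == 0%N)%:R.

Definition ser_mul (R : nzRingType) (a b : series R) : series R :=
  fun n => \sum_(i < n.+1) a i * b (n - i)%N.

Definition ser_deriv (R : nzRingType) (a : series R) : series R :=
  fun n => a n.+1 *+ n.+1.

(* a(-t) *)
Definition ser_neg (R : nzRingType) (a : series R) : series R :=
  fun n => (-1) ^+ n * a n.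

Definition posnat := {m : nat | (0 < m)%N}.

(* The monoid algebra over K of the free monoid on the letters indexed by
   the positive integers, i.e. the free unital associative K-algebra. *)
Notation NSym K := {malg K[{fmonom posnat}]}.

(* The generators, together with Lambda 0 = 1. *)
Definition Lambda (K : nzRingType) (m : nat) : NSym K :=
  if insub m is Some p then << fmu (p : posnat) >> else 1.

Definition is_S (K : nzRingType) (S : nat -> NSym K) : Prop :=
  ser_mul (ser_neg (Lambda K)) S =1 ser_one (NSym K) /\
  ser_mul S (ser_neg (Lambda K)) =1 ser_one (NSym K).

(* S and Xi exist and are unique: see S_Xi_exist and S_Xi_unique.
   The coefficient of t^n in xi(t) is Xi_(n+1); Xi 0 plays no role. *)
Definition is_Xi (K : nzRingType) (S Xi : nat -> NSym K) : Prop :=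
  ser_deriv S =1 ser_mul (fun n => Xi n.+1) S.

Definition seq_pow (R : nzRingType) (w : nat -> R) (I : seq nat) : R :=
  \prod_(i <- I) w i.

Lemma ser_mulA (R : nzRingType) (a b c : series R) :
  ser_mul a (ser_mul b c) =1 ser_mul (ser_mul a b) c.
Proof.
move=> n; pose T (x : series R) := \poly_(i < n.+1) x i.
have TM x y m : (m <= n)%N -> (T x * T y)`_m = ser_mul x y m.
  move=> mn; rewrite coefM; apply: eq_bigr => i _.
  by rewrite !coef_poly !ltnS (leq_trans (leq_ord i) mn)
             (leq_trans (leq_subr _ _) mn).
have : (T a * (T b * T c))`_n = (T a * T b * T c)`_n by rewrite mulrA.
rewrite [LHS]coefM [RHS]coefM => E; rewrite /ser_mul -/(ser_mul _ _).
transitivity (\sum_(i < n.+1) (T a)`_i * (T b * T c)`_(n - i)).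
  apply: eq_bigr => i _; rewrite TM ?leq_subr //.
  by rewrite coef_poly ltn_ord.
rewrite E; apply: eq_bigr => i _; rewrite TM ?leq_ord //.
by rewrite coef_poly ltnS leq_subr.
Qed.

Lemma ser_mul1 (R : nzRingType) (a : series R) :
  ser_mul (ser_one R) a =1 a.
Proof.
move=> n; rewrite /ser_mul big_ord_recl /ser_one eqxx mul1r subn0.
by rewrite big1 ?addr0 // => i _; rewrite mul0r.
Qed.

Lemma ser_mulr1 (R : nzRingType) (a : series R) :
  ser_mul a (ser_one R) =1 a.
Proof.
move=> n; rewrite /ser_mul big_ord_recr /ser_one /= subnn eqxx mulr1.
by rewrite big1 ?add0r // => i _; rewrite subn_eq0 leqNgt ltn_ord mulr0.
Qed.

Lemma eq_ser_mul (R : nzRingType) (a a' b b' : series R) :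
  a =1 a' -> b =1 b' -> ser_mul a b =1 ser_mul a' b'.
Proof. by move=> ea eb n; apply: eq_bigr => i _; rewrite ea eb. Qed.

Lemma ser_left_inv_ex (R : nzRingType) (a : series R) :
  a 0%N = 1 -> exists b, ser_mul b a =1 ser_one R.
Proof.
move=> a0.
pose next (s : seq R) : R :=
  (size s == 0%N)%:R - \sum_(i < size s) s`_i * a (size s - i)%N.
pose pre := fix pre n := if n is n'.+1 then rcons (pre n') (next (pre n'))
                         else [::].
have spre n : size (pre n) = n by elim: n => //= n IH; rewrite size_rcons IH.
pose b n := next (pre n).
have pre_b n i : (i < n)%N -> (pre n)`_i = b i.
  elim: n => // n IH; rewrite ltnS /= nth_rcons spre leq_eqVlt.
  by case: ltngtP => //= [/IH //|-> _].
exists b => n; rewrite /ser_mul big_ord_recr /= subnn a0 mulr1.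
rewrite {2}/b /next spre /ser_one addrC; apply/eqP.
rewrite -subr_eq0 addrAC [_ - _ - _]addrAC subrr sub0r addrC subr_eq0; apply/eqP.
by apply: eq_bigr => i _; rewrite pre_b.
Qed.

Lemma ser_right_inv_ex (R : nzRingType) (a : series R) :
  a 0%N = 1 -> exists b, ser_mul a b =1 ser_one R.
Proof.
move=> a0; have [b bP] := @ser_left_inv_ex R^c a a0.
exists b => n; rewrite -[RHS](bP n) /ser_mul (reindex_inj rev_ord_inj) /=.
by apply: eq_bigr => i _; rewrite subSS subKn ?leq_ord.
Qed.

Lemma S_Xi_exist (K : nzRingType) :
  exists S Xi : nat -> NSym K, is_S S /\ is_Xi S Xi.
Proof.
have L0 : ser_neg (Lambda K) 0%N = 1.
  by rewrite /ser_neg /Lambda mul1r insubF.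
have [b bP] := ser_left_inv_ex L0; have [S SP] := ser_right_inv_ex L0.
have bS : b =1 S.
  move=> n; rewrite -ser_mulr1 -(eq_ser_mul (frefl b) SP) ser_mulA.
  by rewrite (eq_ser_mul bP (frefl S)) ser_mul1.
exists S, (fun n => ser_mul (ser_deriv S) (ser_neg (Lambda K)) n.-1).
split.
  split; first exact: SP.
  by move=> n; rewrite -(eq_ser_mul bS (frefl _)) bP.
move=> n; rewrite -(@ser_mulA _ (ser_deriv S)).
by rewrite (eq_ser_mul (frefl _) SP) ser_mulr1.
Qed.

Lemma S_Xi_unique (K : nzRingType) (S Xi S' Xi' : nat -> NSym K) :
  is_S S -> is_Xi S Xi -> is_S S' -> is_Xi S' Xi' ->
  S =1 S' /\ (forall n, Xi n.+1 = Xi' n.+1).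
Proof.
move=> [LS SL] XS [LS' SL'] XS'.
have SS : S =1 S'.
  move=> n; rewrite -ser_mulr1 -(eq_ser_mul (frefl S) LS') ser_mulA.
  by rewrite (eq_ser_mul SL (frefl S')) ser_mul1.
have E T Y : is_S T -> is_Xi T Y ->
    (fun n => Y n.+1) =1 ser_mul (ser_deriv T) (ser_neg (Lambda K)).
  move=> [_ TL] TY n; rewrite (eq_ser_mul TY (frefl _)) -ser_mulA.
  by rewrite (eq_ser_mul (frefl _) TL) ser_mulr1.
split; first exact: SS.
move=> n; have /= -> := E S Xi (conj LS SL) XS n.
have /= -> := E S' Xi' (conj LS' SL') XS' n.
apply: eq_ser_mul; last exact: frefl.
by move=> m; rewrite /ser_deriv SS.
Qed.

(* Main.v *)
Require Import Defs.
From HB Require Import structures.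
From mathcomp Require Import all_boot all_order all_algebra.
From mathcomp.multinomials Require Import monalg.

Set Implicit Arguments.
Unset Strict Implicit.
Unset Printing Implicit Defensive.

Import GRing.Theory.
Local Open Scope ring_scope.

(** Put l(t) = lambda(-t), the inverse of sigma(t).  Differentiating
    l sigma = 1 and using sigma' = xi sigma gives l' = - l xi
    (ser_inv_deriv), which in degree n reads

      (n+1) l_(n+1) = - (Xi_(n+1) + sum_(1 <= i <= n) l_i Xi_(n+1-i)).

    Both relations for one-part compositions come from iterating this
    recurrence.  Solved for l_(n+1), it peels off the last part n+1-i of a
    composition J of n+1 and divides by n+1 = |J|; the divisors collected
    along the way are the partial sums of J, so the coefficient of Xi^J is
    (-1)^k / pi_u(J), where k is the length of J (deriv_solve_l).
    Solved for Xi_(n+1), it peels off the first part, until the remaining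
    composition has a single part m, where the term - m l_m contributes the
    factor lp(J) = m to the coefficient of l^J (deriv_solve_x).

    For a general composition I one multiplies these expansions over the parts
    of I.  A choice of one composition for each part of I is the same thing as
    a refinement J of I, and the coefficients multiply block by block
    (seq_pow_expand).  The sign (-1)^|I| is the passage from lambda(-t) back
    to lambda(t). *)

(** * Sums over compositions *)

Lemma big_compositions_first (V : nmodType) (F : seq nat -> V) (n : nat) :
  \sum_(J <- compositions n.+1) F J =
    F [:: n.+1] +
    \sum_(i < n) \sum_(J <- compositions (n - i)) F (i.+1 :: J).
Proof.
elim: n F => [|n IH] F; first by rewrite big_seq1 big_ord0 addr0.
rewrite compositionsSS big_cat !big_map /= (IH (fun J => F (incr_nth J 0))).
by rewrite [in RHS]big_ord_recl addrCA.
Qed.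

Lemma big_compositions_last (V : nmodType) (F : seq nat -> V) (n : nat) :
  \sum_(J <- compositions n.+1) F J =
    F [:: n.+1] +
    \sum_(i < n) \sum_(J <- compositions i.+1) F (rcons J (n - i)%N).
Proof.
elim: n F => [|n IH] F; first by rewrite big_seq1 big_ord0 addr0.
rewrite compositionsSS big_cat !big_map /= (IH (fun J => F (1%N :: J))).
rewrite (IH (fun J => F (incr_nth J 0))) [in RHS]big_ord_recl big_seq1.
rewrite addrCA -!addrA; congr (_ + (_ + _)).
rewrite -big_split; apply: eq_bigr => i _.
rewrite lift0 subSS big_cat !big_map; congr (_ + _).
(* Incrementing the first part commutes with appending only for nonempty J. *)
apply: eq_big_seq => J; rewrite mem_compositions.
by case: J.
Qed.

(** * Refinements as products of compositions *)

(** The list is built block by block so that a sum over it factors as a product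
    over the parts of I; perm_refinements identifies it with the filtered list
    of compositions. *)
Fixpoint refinements (I : seq nat) : seq (seq nat) :=
  if I is i :: I' then
    [seq B ++ J | B <- compositions i, J <- refinements I']
  else [:: [::]].

(** The parts of B are positive with sum i, so B is the shortest prefix of weight
    at least i.  Besides computing block-multiplicative coefficients, this shows
    that B and J are determined by B ++ J. *)
Lemma blocks_cat (i : nat) (I B J : seq nat) :
  B \in compositions i -> blocks (i :: I) (B ++ J) = B :: blocks I J.
Proof.
rewrite mem_compositions => /andP[/andP[_ Bp] /eqP <-] /=.
by rewrite prefix_len_cat // take_size_cat // drop_size_cat.
Qed.

Lemma mem_refinements (I J : seq nat) : (J \in refinements I) = refines J I.
Proof.
elim: I J => [|i I IH] J.
  by rewrite inE /refines /is_decomposition /= andbT eq_sym.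
apply/allpairsP/refinesP => [[[B J']] /= [Bi]|].
  rewrite IH => /refinesP[D /and3P[Dc /eqP Df /eqP Ds]] ->.
  exists (B :: D); rewrite mem_compositions in Bi.
  case/andP: Bi => Bc /eqP Bs.
  by rewrite /is_decomposition /= Bc Dc Df Ds Bs !eqxx.
case=> -[|B D] /and3P[//= /andP[Bc Dc] /eqP <- /eqP[Bs Ds]].
exists (B, flatten D) => /=; rewrite mem_compositions Bc Bs eqxx IH.
by split=> //; apply/refinesP; exists D; rewrite /is_decomposition Dc Ds !eqxx.
Qed.

Lemma refinements_uniq (I : seq nat) : uniq (refinements I).
Proof.
elim: I => // i I IH; apply: allpairs_uniq => //; first exact: compositions_uniq.
move=> [B J] [B' J'] /allpairsP[[B1 J1] /= [B1i _ [-> ->]]].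
move=> /allpairsP[[B2 J2] /= [B2i _ [-> ->]]] eqBJ.
have := congr1 (blocks [:: i]) eqBJ; rewrite !blocks_cat // => -[eqB].
by move/eqP: eqBJ; rewrite eqB eqseq_cat // eqxx => /eqP ->.
Qed.

(** The composition I has to be nonempty: the empty sequence refines itself, but
    it is not among the compositions of 0. *)
Lemma perm_refinements (I : seq nat) : is_composition I ->
  perm_eq [seq J <- compositions (sumn I) | refines J I] (refinements I).
Proof.
move=> /andP[I0 _]; apply: uniq_perm => [||J].
- exact/filter_uniq/compositions_uniq.
- exact: refinements_uniq.
rewrite mem_filter mem_refinements mem_compositions andb_idr //.
move=> /refinesP[B /and3P[Bc /eqP <- /eqP IB]].
rewrite -IB sumn_flatten eqxx andbT; apply/andP; split.
  case: B Bc IB => [|b B] /=; first by move=> _ I_; rewrite -I_ in I0.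
  by case: b.
apply/allP => j /flattenP[b bB jb].
by have /andP[_ /allP] := allP Bc _ bB; apply.
Qed.

Lemma seq_pow_cons (R : nzRingType) (w : nat -> R) (i : nat) (I : seq nat) :
  seq_pow w (i :: I) = w i * seq_pow w I.
Proof. exact: big_cons. Qed.

Lemma seq_pow_cat (R : nzRingType) (w : nat -> R) (I J : seq nat) :
  seq_pow w (I ++ J) = seq_pow w I * seq_pow w J.
Proof. exact: big_cat. Qed.

(** Distributivity: the product over the parts of I of sums over compositions is
    a sum over the refinements of I, with block-multiplicative coefficients.
    Centrality of the scalars lets the coefficients be collected in front. *)
Lemma seq_pow_expand (K : comNzRingType) (A : algType K) (v w : nat -> A)
    (s : nat -> K) (c : seq nat -> K) (I : seq nat) :
  (forall n, v n.+1 =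
     s n.+1 *: \sum_(B <- compositions n.+1) c B *: seq_pow w B) ->
  is_composition I ->
  seq_pow v I = (\prod_(i <- I) s i) *:
    \sum_(J <- compositions (sumn I) | refines J I)
       (\prod_(B <- blocks I J) c B) *: seq_pow w J.
Proof.
move=> vE cI.
rewrite -[X in _ *: X]big_filter (perm_big _ (perm_refinements cI)) /=.
case/andP: cI => _; elim: I => [_|[//|i] I IH cI].
  by rewrite big_seq1 /seq_pow !big_nil !scale1r.
have {}IH := IH cI.
rewrite seq_pow_cons IH vE big_cons -scalerAl -scalerAr scalerA.
congr (_ *: _); rewrite big_allpairs_dep mulr_suml; apply: eq_big_seq => B Bi.
rewrite mulr_sumr; apply: eq_bigr => J _.
by rewrite blocks_cat // big_cons seq_pow_cat -scalerAl -scalerAr scalerA.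
Qed.

Lemma prod_sign_blocks (R : comNzRingType) (I J : seq nat) : refines J I ->
  \prod_(B <- blocks I J) (-1) ^+ size B = (-1) ^+ size J :> R.
Proof.
case/and3P=> _ /eqP JE _.
by rewrite -[in RHS]JE size_flatten sumnE big_map expr_sum.
Qed.

(** * The differential equation satisfied by lambda(-t) *)

Lemma ser_derivM (R : nzRingType) (a b : series R) :
  ser_deriv (ser_mul a b) =1
  fun n => ser_mul (ser_deriv a) b n + ser_mul a (ser_deriv b) n.
Proof.
move=> n; rewrite /ser_deriv /ser_mul.
transitivity (\sum_(i < n.+2) (a i *+ i * b (n.+1 - i)%N)
            + \sum_(i < n.+2) (a i * (b (n.+1 - i)%N *+ (n.+1 - i)%N))).
  rewrite -big_split -sumrMnl; apply: eq_bigr => i _ /=.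
  by rewrite mulrnAl mulrnAr -mulrnDr subnKC // -ltnS.
congr (_ + _).
  by rewrite big_ord_recl mulr0n mul0r add0r.
rewrite big_ord_recr /= subnn mulr0n mulr0 addr0; apply: eq_bigr => i _.
by rewrite subSn // -ltnS.
Qed.

(** From l s = 1 and s' = x s one gets (l' + l x) s = 0; multiplying on the right
    by l, the inverse of s, gives l' = - l x. *)
Lemma ser_inv_deriv (R : nzRingType) (l s x : series R) :
  ser_mul l s =1 ser_one R -> ser_mul s l =1 ser_one R ->
  ser_deriv s =1 ser_mul x s ->
  forall n, ser_deriv l n = - ser_mul l x n.
Proof.
move=> ls sl ds n.
have D m : ser_mul (ser_deriv l) s m = - ser_mul (ser_mul l x) s m.
  apply/eqP; rewrite -addr_eq0 -ser_mulA -(eq_ser_mul (frefl l) ds).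
  by rewrite -ser_derivM /ser_deriv ls /ser_one mul0rn.
rewrite -ser_mulr1 -(eq_ser_mul (frefl _) sl) ser_mulA (eq_ser_mul D (frefl l)).
rewrite -[in RHS]ser_mulr1 -(eq_ser_mul (frefl _) sl) [in RHS]ser_mulA.
by rewrite /ser_mul -sumrN; apply: eq_bigr => i _; rewrite mulNr.
Qed.

(** * Solving the recurrence *)

(** Appending a part multiplies pi_u by the total weight; this is why the
    coefficients 1 / pi_u arise from a recursion on the last part. *)
Lemma pi_u_rcons (J : seq nat) (k : nat) :
  pi_u (rcons J k) = (pi_u J * (sumn J + k))%N.
Proof.
rewrite /pi_u size_rcons big_ord_recr /= -cats1 take_oversize ?size_cat ?addn1 //.
rewrite sumn_cat /= addn0; congr (_ * _)%N; apply: eq_bigr => i _.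
by rewrite takel_cat.
Qed.

Lemma deriv_recl (R : nzRingType) (l x : nat -> R) : l 0 = 1 ->
  ser_deriv l =1 (fun n => - ser_mul l (fun m => x m.+1) n) ->
  forall n,
  l n.+1 *+ n.+1 = - (x n.+1 + \sum_(i < n) l i.+1 * x (n - i)%N).
Proof.
move=> l0 dl n; have /= := dl n; rewrite /ser_deriv /ser_mul => ->.
rewrite big_ord_recl l0 mul1r subn0; congr (- (_ + _)).
by apply: eq_bigr => i _; rewrite lift0 subnSK.
Qed.

(** This is where the rational scalars of K act: they undo the factor n+1 that
    differentiation puts on the coefficient of degree n+1. *)
Lemma mulrn_scaleK (K : comAlgType rat) (V : lmodType K) n (y z : V) :
  y *+ n.+1 = z -> y = ((n.+1%:R)^-1 : rat)%:A *: z.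
Proof.
move=> <-; rewrite -scaler_nat scalerA -scaler_nat -scalerAl mul1r scalerA.
by rewrite mulVf ?Num.Theory.pnatr_eq0 // !scale1r.
Qed.

(** Strong induction on n: the i-th term of the recurrence contributes the
    compositions of n+1 whose last part is n-i. *)
Lemma deriv_solve_l (K : comAlgType rat) (A : algType K) (l x : nat -> A) :
  l 0 = 1 ->
  ser_deriv l =1 (fun n => - ser_mul l (fun m => x m.+1) n) ->
  forall n, l n.+1 = \sum_(J <- compositions n.+1)
    ((-1) ^+ size J / (pi_u J)%:R : rat)%:A *: seq_pow x J.
Proof.
move=> l0 dl; elim/ltn_ind=> n IH; rewrite (mulrn_scaleK (deriv_recl l0 dl n)).
rewrite big_compositions_last scalerN scalerDr opprD; congr (_ + _).
  rewrite /pi_u big_ord_recl big_ord0 muln1 /= addn0 /seq_pow big_seq1.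
  by rewrite expr1 mulN1r scaleNr scaleNr.
rewrite scaler_sumr -sumrN; apply: eq_bigr => i _; rewrite IH //.
rewrite mulr_suml scaler_sumr -sumrN; apply: eq_big_seq => J.
rewrite mem_compositions => /andP[_ /eqP sJ].
rewrite pi_u_rcons sJ addSn subnKC ?(ltnW (ltn_ord i)) // size_rcons.
rewrite -cats1 seq_pow_cat /(seq_pow x [:: _]) big_seq1 -scalerAl scalerA.
rewrite -scalerAl mul1r scalerA -scaleNr -scaleNr; congr (_ *: _ *: _).
rewrite natrM invfM exprS mulN1r mulNr; congr (- _).
by rewrite [LHS]mulrC mulrA.
Qed.

(** Strong induction on n: the i-th term of the recurrence contributes the
    compositions of n+1 whose first part is i+1, and lp is unchanged by adding
    a part in front. *)
Lemma deriv_solve_x (K : comNzRingType) (A : algType K) (l x : nat -> A) :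
  l 0 = 1 ->
  ser_deriv l =1 (fun n => - ser_mul l (fun m => x m.+1) n) ->
  forall n, x n.+1 = \sum_(J <- compositions n.+1)
    ((-1) ^+ size J * (lp J)%:R) *: seq_pow l J.
Proof.
move=> l0 dl; elim/ltn_ind=> n IH.
have -> : x n.+1 = - (l n.+1 *+ n.+1) - \sum_(i < n) l i.+1 * x (n - i)%N.
  by rewrite (deriv_recl l0 dl) opprK addrK.
rewrite big_compositions_first; congr (_ + _).
  by rewrite expr1 mulN1r scaleNr /seq_pow big_seq1 scaler_nat.
rewrite -sumrN; apply: eq_bigr => i _.
have lt_i := ltn_ord i; rewrite -(subnSK lt_i) IH; last first.
  by rewrite ltn_subrL (leq_ltn_trans _ lt_i).
rewrite mulr_sumr -sumrN; apply: eq_big_seq => J.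
rewrite mem_compositions.
(* J is nonempty, so consing a part does not change its last part. *)
case: J => // j J _.
rewrite [in RHS]seq_pow_cons -scalerAr -scaleNr.
by rewrite [size (_ :: _ :: _)]/= [in RHS]exprS mulN1r mulNr.
Qed.

(** * The relations *)

Lemma scale_sign (K : comNzRingType) (A : algType K) n (y : A) :
  (-1) ^+ n *: y = (-1) ^+ n * y.
Proof. by rewrite -signr_odd -[in RHS]signr_odd scaler_sign mulr_sign. Qed.

Lemma prod_sign_sumn (R : nzRingType) (I : seq nat) :
  \prod_(i <- I) (-1) ^+ i = (-1) ^+ sumn I :> R.
Proof. by rewrite sumnE expr_sum. Qed.

(** Put l_n = (-1)^n L_n, the coefficients of lambda(-t).  Each relation
    for l turns into one for L at the cost of the sign (-1)^|I| on the left, or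
    (-1)^|J| = (-1)^|I| for the products on the right. *)
Lemma Lambda_Xi_relations (K : comAlgType rat) (A : algType K)
    (L S X : nat -> A) (I : seq nat) :
  L 0 = 1 ->
  ser_mul (ser_neg L) S =1 ser_one A -> ser_mul S (ser_neg L) =1 ser_one A ->
  ser_deriv S =1 ser_mul (fun n => X n.+1) S ->
  is_composition I ->
  seq_pow L I =
    (-1) ^+ sumn I *:
      \sum_(J <- compositions (sumn I) | refines J I)
        ((-1) ^+ size J / (pi_u2 J I)%:R : rat)%:A *: seq_pow X J
  /\
  seq_pow X I =
    (-1) ^+ sumn I *:
      \sum_(J <- compositions (sumn I) | refines J I)
        ((-1) ^+ size J * (lp2 J I)%:R) *: seq_pow L J.
Proof.
move=> L0 LS SL dS cI.
pose l := ser_neg L.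
have l0 : l 0 = 1 by rewrite /l /ser_neg L0 mulr1.
have dl := ser_inv_deriv LS SL dS.
have LE n : L n = (-1) ^+ n *: l n.
  by rewrite /l /ser_neg -scale_sign scalerA -expr2 sqrr_sign scale1r.
have lE J : seq_pow l J = (-1) ^+ sumn J *: seq_pow L J.
  elim: J => [|j J IH]; first by rewrite /seq_pow !big_nil scale1r.
  rewrite !seq_pow_cons IH LE /= -scalerAl -scalerAr !scalerA exprD.
  by rewrite mulrAC -expr2 sqrr_sign mul1r.
split.
  rewrite (seq_pow_expand (w := X) (s := fun n => (-1) ^+ n)
    (c := fun B => ((-1) ^+ size B / (pi_u B)%:R : rat)%:A) _ cI); last first.
    by move=> n; rewrite LE (deriv_solve_l l0 dl).
  rewrite prod_sign_sumn; congr (_ *: _); apply: eq_bigr => J IJ.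
  rewrite -(rmorph_prod (in_alg K)) big_split /= prod_sign_blocks //.
  by rewrite prodfV -natr_prod.
rewrite (seq_pow_expand (w := L) (s := fun n => (-1) ^+ n)
    (c := fun B => (-1) ^+ size B * (lp B)%:R) _ cI).
  rewrite prod_sign_sumn; congr (_ *: _); apply: eq_bigr => J IJ.
  by rewrite big_split /= prod_sign_blocks // -natr_prod.
move=> n; rewrite (deriv_solve_x l0 dl) scaler_sumr; apply: eq_big_seq => J.
rewrite mem_compositions => /andP[_ /eqP sJ].
by rewrite lE sJ !scalerA mulrC.
Qed.

Lemma malg_scaleAr (M : monomType) (K : comNzRingType) (k : K)
    (a b : {malg K[M]}) : k *: (a * b) = a * (k *: b).
Proof.
apply/malgP=> m; rewrite mcoeffZ mcoeffMl.
rewrite (mcoeffMlw _ (finmap.fsubset_refl _) (msuppZ_le k b)) big_distrr /=.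
apply: eq_bigr => m1 _; rewrite big_distrr; apply: eq_bigr => m2 _ /=.
by rewrite mcoeffZ mulrnAr mulrCA.
Qed.

(** Over a commutative ring the scalars are central in the monoid algebra even
    when the monoid is not commutative.  The structure is packed explicitly
    because the canonical one is attached to commutative monoids. *)
Definition malg_algType (M : monomType) (K : comNzRingType) : algType K :=
  HB.pack (malg M K)
    (GRing.Lalgebra_isAlgebra.Build K (malg M K) (@malg_scaleAr M K)).

Theorem mainTheorem10 (K : comAlgType rat) (S Xi : nat -> NSym K)
    (hS : is_S S) (hXi : is_Xi S Xi) (I : seq nat) (hI : is_composition I) :
  seq_pow (Lambda K) I =
    (-1) ^+ sumn I *:
      \sum_(J <- compositions (sumn I) | refines J I)
        ((-1) ^+ size J / (pi_u2 J I)%:R : rat)%:A *: seq_pow Xi J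
  /\
  seq_pow Xi I =
    (-1) ^+ sumn I *:
      \sum_(J <- compositions (sumn I) | refines J I)
        ((-1) ^+ size J * (lp2 J I)%:R) *: seq_pow (Lambda K) J.
Proof.
case: hS => LS SL.
apply: (@Lambda_Xi_relations K (malg_algType _ K) (Lambda K) S Xi) => //.
by rewrite /Lambda insubF.
Qed.
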